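(* Let $(\mathcal{A},[\cdot,\cdot],N)$ be a Nijenhuis mock-Lie algebra, let $r=\sum_ia_i\otimes b_i\in\mathcal{A}\otimes\mathcal{A}$ be antisymmetric, and let $S:\mathcal{A}\to\mathcal{A}$ be a linear map. Let $T_r:\mathcal{A}^*\to\mathcal{A}$ be the linear map $T_r(x^* )=\sum_i\langle x^*,a_i\rangle b_i$. Then $r$ is a solution of the $S$-admissible mock-Lie-Yang-Baxter equation in $(\mathcal{A},[\cdot,\cdot],N)$ if and only if $T_r$ satisfies $$[T_r(x^* ),T_r(y^* )]=T_r\bigl(ad^*(T_r(x^* ))y^*+ad^*(T_r(y^* ))x^*\bigr)\quad\text{for all }x^*,y^*\in\mathcal{A}^*,$$ $$N\circ T_r=T_r\circ S^*.$$
   Context: All vector spaces are over a field $K$ of characteristic zero. A mock-Lie algebra is a vector space with a commutative bilinear map $[\cdot,\cdot]$ such that $[x,[y,z]]+[y,[z,x]]+[z,[x,y]]=0$. A Nijenhuis mock-Lie algebra $(\mathcal{A},[\cdot,\cdot],N)$ is a mock-Lie algebra with a linear map $N$ such that $[N(x),N(y)]+N^2([x,y])=N([N(x),y])+N([x,N(y)])$. For $r=\sum_ia_i\otimes b_i$, the $S$-admissible mock-Lie-Yang-Baxter equation in $(\mathcal{A},[\cdot,\cdot],N)$ is the system $$\sum_{i,j}\bigl([a_i,a_j]\otimes b_i\otimes b_j+a_i\otimes a_j\otimes[b_i,b_j]-a_i\otimes[b_i,a_j]\otimes b_j\bigr)=0,\quad(N\otimes\mathrm{id}-\mathrm{id}\otimes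 S)(r)=0,\quad(S\otimes\mathrm{id}-\mathrm{id}\otimes N)(r)=0.$$ $r$ is antisymmetric if $r=-\tau(r)$, $\tau$ the flip. The map $ad^*:\mathcal{A}\to\mathrm{End}(\mathcal{A}^* )$ is $\langle ad^*(x)a^*,y\rangle=\langle a^*,[x,y]\rangle$, and $S^*$ is the transpose of $S$. *)

(* Defs.v *)
From HB Require Import structures.
From mathcomp Require Import all_boot all_order all_algebra.
From mathcomp.multinomials Require Import freeg.
From mathcomp.classical Require Import boolp.

Set Implicit Arguments.
Unset Strict Implicit.
Unset Printing Implicit Defensive.

Import GRing.Theory.
Local Open Scope ring_scope.
Local Open Scope quotient_scope.

Section LinearMaps.
Variables (K : fieldType) (U V : lmodType K).
Implicit Types f g h : {linear U -> V}.

HB.instance Definition _ := gen_eqMixin {linear U -> V}.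
HB.instance Definition _ := gen_choiceMixin {linear U -> V}.

Lemma linear_ext f g : f =1 g -> f = g.
Proof.
case: f g => [f [[Af] [Bf]]] [g [[Ag] [Bg]]] /= /funext efg.
case: g / efg Ag Bg => Ag Bg.
by rewrite (Prop_irrelevance Af Ag) (Prop_irrelevance Bf Bg).
Qed.

Definition linear_zero : {linear U -> V} := \0.
Definition linear_opp f : {linear U -> V} := \- f.
Definition linear_add f g : {linear U -> V} := f \+ g.
Definition linear_scale (k : K) f : {linear U -> V} := k \*: f.

Lemma linear_addA : associative linear_add.
Proof. by move=> f g h; apply: linear_ext => x /=; rewrite addrA. Qed.
Lemma linear_addC : commutative linear_add.
Proof. by move=> f g; apply: linear_ext => x /=; rewrite addrC. Qed.
Lemma linear_add0 : left_id linear_zero linear_add.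
Proof. by move=> f; apply: linear_ext => x /=; rewrite add0r. Qed.
Lemma linear_addN : left_inverse linear_zero linear_opp linear_add.
Proof. by move=> f; apply: linear_ext => x /=; rewrite addNr. Qed.

HB.instance Definition _ := GRing.isZmodule.Build {linear U -> V}
  linear_addA linear_addC linear_add0 linear_addN.

Lemma linear_scaleA (k l : K) f :
  linear_scale k (linear_scale l f) = linear_scale (k * l) f.
Proof. by apply: linear_ext => x /=; rewrite scalerA. Qed.
Lemma linear_scale1 : left_id 1 linear_scale.
Proof. by move=> f; apply: linear_ext => x /=; rewrite scale1r. Qed.
Lemma linear_scaleDr : right_distributive linear_scale +%R.
Proof. by move=> k f g; apply: linear_ext => x /=; rewrite scalerDr. Qed.
Lemma linear_scaleDl f : {morph linear_scale^~ f : k l / k + l}.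
Proof. by move=> k l; apply: linear_ext => x /=; rewrite scalerDl. Qed.

HB.instance Definition _ := GRing.Zmodule_isLmodule.Build K {linear U -> V}
  linear_scaleA linear_scale1 linear_scaleDr linear_scaleDl.

Lemma add_linearE f g x : (f + g) x = f x + g x. Proof. by []. Qed.
Lemma scale_linearE (k : K) f x : (k *: f) x = k *: f x. Proof. by []. Qed.

End LinearMaps.

Notation dual A := {linear A -> GRing.regular _}.

Section Transpose.
Variables (K : fieldType) (A B : lmodType K) (f : {linear A -> B}).

Definition transpose_fun (u : {linear B -> K^o}) : {linear A -> K^o} := u \o f.

Fact transpose_is_linear : linear transpose_fun.
Proof. by move=> k u v; apply: linear_ext. Qed.

HB.instance Definition _ := GRing.isLinear.Build K
  {linear B -> K^o} {linear A -> K^o} _ transpose_fun transpose_is_linear.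

Definition transpose : {linear dual B -> dual A} := transpose_fun.

End Transpose.

Section TensorProduct.
Variables (K : fieldType) (A B : lmodType K).
Local Notation free := {freeg (A * B)%type / K}.
Local Notation gen a b := (<< (a, b) >> : free).

(* The subspace of the free vector space on A * B spanned by the bilinearity
   relators. *)
Inductive tensor_null : free -> Prop :=
| tensor_null0 : tensor_null 0
| tensor_nullP (k : K) (x y : free) :
    tensor_null x -> tensor_null y -> tensor_null (k *: x + y)
| tensor_nullDl a a' b :
    tensor_null (gen (a + a') b - gen a b - gen a' b)
| tensor_nullDr a b b' :
    tensor_null (gen a (b + b') - gen a b - gen a b')
| tensor_nullZl (k : K) a b : tensor_null (gen (k *: a) b - k *: gen a b)
| tensor_nullZr (k : K) a b : tensor_null (gen a (k *: b) - k *: gen a b).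

Definition tensor_nullb (x : free) : bool := `[< tensor_null x >].

Fact tensor_null_submod : submod_closed tensor_nullb.
Proof.
split=> [|k x y /asboolP hx /asboolP hy]; apply/asboolP.
  exact: tensor_null0.
exact: tensor_nullP.
Qed.

HB.instance Definition _ :=
  GRing.isSubmodClosed.Build K free tensor_nullb tensor_null_submod.

Definition tensor := Quotient.quot (GRing.ZmodClosed.clone free tensor_nullb _).

HB.instance Definition _ := Choice.on tensor.
HB.instance Definition _ := GRing.Zmodule.on tensor.
HB.instance Definition _ := Quotient.on tensor.
HB.instance Definition _ := ZmodQuotient.on tensor.

Lemma tensor_reprK (t : tensor) : \pi_tensor (repr t) = t.
Proof. exact: reprK. Qed.

Lemma tensor_piP (x y : free) :
  tensor_null (x - y) <-> \pi_tensor x = \pi_tensor y.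
Proof.
split=> [h|/eqP]; last by rewrite -Quotient.idealrBE => /asboolP.
by apply/eqP; rewrite -Quotient.idealrBE; apply/asboolP.
Qed.

Definition tensor_scale (k : K) (t : tensor) : tensor := \pi_tensor (k *: repr t).

Lemma tensor_scale_pi (k : K) (x : free) :
  tensor_scale k (\pi_tensor x) = \pi_tensor (k *: x).
Proof.
apply/tensor_piP; rewrite -scalerBr -[_ *: _]addr0.
apply: tensor_nullP; last exact: tensor_null0.
by apply/tensor_piP; rewrite reprK.
Qed.

Fact tensor_scaleA (k l : K) t :
  tensor_scale k (tensor_scale l t) = tensor_scale (k * l) t.
Proof. by rewrite -[t]tensor_reprK !tensor_scale_pi scalerA. Qed.
Fact tensor_scale1 : left_id 1 tensor_scale.
Proof. by move=> t; rewrite -[t]tensor_reprK tensor_scale_pi scale1r. Qed.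
Fact tensor_scaleDr : right_distributive tensor_scale +%R.
Proof.
move=> k t u; rewrite -[t]tensor_reprK -[u]tensor_reprK -raddfD !tensor_scale_pi.
by rewrite scalerDr raddfD.
Qed.
Fact tensor_scaleDl t : {morph tensor_scale^~ t : k l / k + l}.
Proof.
by move=> k l; rewrite -[t]tensor_reprK !tensor_scale_pi scalerDl raddfD.
Qed.

HB.instance Definition _ := GRing.Zmodule_isLmodule.Build K tensor
  tensor_scaleA tensor_scale1 tensor_scaleDr tensor_scaleDl.

Definition tens (a : A) (b : B) : tensor := \pi_tensor (gen a b).

Lemma pi_tensorZ (k : K) (x : free) :
  \pi_tensor (k *: x) = k *: \pi_tensor x.
Proof. by rewrite -tensor_scale_pi. Qed.

Fact tens_is_bilinear : bilinear_for *:%R *:%R tens.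
Proof.
split=> [b|a] k x y; rewrite /tens /= -pi_tensorZ -raddfD.
  transitivity (\pi_tensor (gen (k *: x) b + gen y b)).
    by apply/tensor_piP; rewrite opprD addrA; apply: tensor_nullDl.
  apply/tensor_piP; rewrite opprD addrACA subrr addr0.
  exact: tensor_nullZl.
transitivity (\pi_tensor (gen a (k *: x) + gen a y)).
  by apply/tensor_piP; rewrite opprD addrA; apply: tensor_nullDr.
apply/tensor_piP; rewrite opprD addrACA subrr addr0.
exact: tensor_nullZr.
Qed.

HB.instance Definition _ := bilinear_isBilinear.Build K A B tensor
  *:%R *:%R tens tens_is_bilinear.

Section Lift.
Variables (C : lmodType K) (f : {bilinear A -> B -> C}).

Definition free_lift : free -> C := fglift (fun p : A * B => f p.1 p.2).

Fact free_lift_is_zmod_morphism : zmod_morphism free_lift.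
Proof. exact: lift_is_additive. Qed.

HB.instance Definition _ := GRing.isZmodMorphism.Build free C free_lift
  free_lift_is_zmod_morphism.

Lemma free_lift_gen (k : K) a b : free_lift << k *g (a, b) >> = k *: f a b.
Proof. exact: liftU. Qed.

Lemma free_liftZ (k : K) x : free_lift (k *: x) = k *: free_lift x.
Proof.
rewrite -[x]freeg_sumE scaler_sumr !raddf_sum.
apply: eq_bigr => -[a b] _; rewrite /= free_lift_gen scalerA -free_lift_gen.
by congr free_lift; apply/eqP/freeg_eqP => z; rewrite coeffZ !coeffU mulrA.
Qed.

Lemma free_lift_null x : tensor_null x -> free_lift x = 0.
Proof.
elim=> [|k {}x y _ hx _ hy|a a' b|a b b'|k a b|k a b].
- exact: raddf0.
- by rewrite raddfD /= free_liftZ hx hy scaler0 addr0.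
- by rewrite !raddfB /= !free_lift_gen !scale1r linearDl addrAC addrK subrr.
- by rewrite !raddfB /= !free_lift_gen !scale1r linearDr addrAC addrK subrr.
- by rewrite raddfB /= free_liftZ !free_lift_gen !scale1r linearZl subrr.
- by rewrite raddfB /= free_liftZ !free_lift_gen !scale1r linearZr subrr.
Qed.

Definition tens_lift_fun (t : tensor) : C := free_lift (repr t).

Lemma tens_lift_pi x : tens_lift_fun (\pi_tensor x) = free_lift x.
Proof.
apply/eqP; rewrite -subr_eq0 -raddfB; apply/eqP/free_lift_null.
by apply/tensor_piP; rewrite reprK.
Qed.

Fact tens_lift_is_linear : linear tens_lift_fun.
Proof.
move=> k t u; rewrite -[t]tensor_reprK -[u]tensor_reprK -pi_tensorZ -raddfD.
by rewrite !tens_lift_pi raddfD /= free_liftZ.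
Qed.

HB.instance Definition _ :=
  GRing.isLinear.Build K tensor C _ tens_lift_fun tens_lift_is_linear.

Definition tens_lift : {linear tensor -> C} := tens_lift_fun.

Lemma tens_liftE a b : tens_lift (tens a b) = f a b.
Proof. by rewrite /= tens_lift_pi free_lift_gen scale1r. Qed.

End Lift.

End TensorProduct.

Notation "a *t b" := (tens a b) (at level 40, left associativity) : ring_scope.

Section TensorMaps.
Variables (K : fieldType) (A B A' B' : lmodType K).

Section Map.
Variables (f : {linear A -> A'}) (g : {linear B -> B'}).

Definition tens_map_pre (a : A) (b : B) : tensor A' B' := f a *t g b.

Fact tens_map_is_bilinear : bilinear_for *:%R *:%R tens_map_pre.
Proof.
split=> [b|a] k x y; rewrite /tens_map_pre /= linearP ?linearDl ?linearDr /=.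
  by rewrite linearZl.
by rewrite linearZr.
Qed.

HB.instance Definition _ := bilinear_isBilinear.Build K A B (tensor A' B')
  *:%R *:%R tens_map_pre tens_map_is_bilinear.

Definition tens_map : {linear tensor A B -> tensor A' B'} :=
  tens_lift tens_map_pre.

Lemma tens_mapE a b : tens_map (a *t b) = f a *t g b.
Proof. exact: tens_liftE. Qed.

End Map.

Definition tens_flip_pre (a : A) (b : B) : tensor B A := b *t a.

Fact tens_flip_is_bilinear : bilinear_for *:%R *:%R tens_flip_pre.
Proof.
split=> [b|a] k x y; rewrite /tens_flip_pre /= ?linearDl ?linearDr /=.
  by rewrite linearZr.
by rewrite linearZl.
Qed.

HB.instance Definition _ := bilinear_isBilinear.Build K A B (tensor B A)
  *:%R *:%R tens_flip_pre tens_flip_is_bilinear.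

Definition tens_flip : {linear tensor A B -> tensor B A} :=
  tens_lift tens_flip_pre.

Lemma tens_flipE a b : tens_flip (a *t b) = b *t a.
Proof. exact: tens_liftE. Qed.

End TensorMaps.

Section MockLie.
Variables (K : fieldType) (A : lmodType K) (br : {bilinear A -> A -> A}).
Implicit Types (N S : {linear A -> A}) (r : tensor A A).

Definition is_mock_lie : Prop :=
  (forall x y, br x y = br y x) /\
  (forall x y z, br x (br y z) + br y (br z x) + br z (br x y) = 0).

Definition is_nijenhuis N : Prop :=
  forall x y, br (N x) (N y) + N (N (br x y)) = N (br (N x) y) + N (br x (N y)).

Definition antisymmetric_tensor r : Prop := r = - tens_flip A A r.

Definition mlybe n (a b : 'I_n -> A) : tensor (tensor A A) A :=
  \sum_(i < n) \sum_(j < n)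
    (br (a i) (a j) *t b i *t b j + a i *t a j *t br (b i) (b j)
     - a i *t br (b i) (a j) *t b j).

(* [a] and [b] are the components of a decomposition of [r] into pure
   tensors. *)
Definition admissible_mlybe N S r n (a b : 'I_n -> A) : Prop :=
  [/\ mlybe a b = 0,
      (tens_map N idfun \- tens_map idfun S) r = 0
    & (tens_map S idfun \- tens_map idfun N) r = 0].

Definition coad (x : A) : {linear dual A -> dual A} := transpose (br x).

Section Tr.
Variables (n : nat) (a b : 'I_n -> A).

Definition Tr_fun (u : dual A) : A := \sum_(i < n) (u (a i) : K) *: b i.

Fact Tr_is_linear : linear Tr_fun.
Proof.
move=> k u v; rewrite /Tr_fun scaler_sumr -big_split /=.
by apply: eq_bigr => i _; rewrite scalerDl scalerA.
Qed.

HB.instance Definition _ :=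
  GRing.isLinear.Build K (dual A) A _ Tr_fun Tr_is_linear.

Definition Tr : {linear dual A -> A} := Tr_fun.

End Tr.

End MockLie.

(* Main.v *)
From HB Require Import structures.
Require Import Defs.
From mathcomp Require Import all_boot all_order all_algebra.
From mathcomp.multinomials Require Import freeg.
From mathcomp.classical Require Import boolp classical_sets.

Set Implicit Arguments.
Unset Strict Implicit.
Unset Printing Implicit Defensive.

Import GRing.Theory.
Local Open Scope ring_scope.

(** Write [slice w] for the contraction of the right factor of a tensor by a
functional [w].  Antisymmetry of [r] says that [slice w r = - T w], where [T]
is [Tr a b], whereas [T w] itself contracts the left factor.  Contracting the
last two factors of the mock-Lie-Yang-Baxter expression by [u] and [v], the
three terms become [[T u, T v]], [- T (coad (T u) v)] and
[- T (coad (T v) u)], so the result is exactly the defect in the operator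
identity ([slice_mlybe]).  Likewise the contraction of
[(N (x) id - id (x) S) r] by [u] is [T (S^* u) - N (T u)].  The remaining
condition on [r] is, by antisymmetry, the flip of this one.

Hence each operator identity says that all the slices of a tensor vanish, and
the theorem reduces to the fact that such a tensor is zero ([slice_eq0]).
[A] may be infinite-dimensional, so this rests on the existence of functionals
separating a vector from a subspace ([separating_functional]), which comes
from Zorn's lemma. *)

(** * Functionals separating a vector from a subspace *)

Section Functionals.
Variables (K : fieldType) (V : lmodType K).

(** A subspace [M] with [V = M + K x] and [x] outside [M] is a hyperplane: the
coefficient of [x] in the decomposition of a vector is unique, hence linear. *)
Lemma hyperplane_functional (M : set V) (x : V) :
  M 0 -> (forall (k : K) y z, M y -> M z -> M (k *: y + z)) -> ~ M x ->
  (forall y, exists k : K, M (y - k *: x)) ->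
  exists2 u : dual V, (forall y, M y -> u y = 0) & u x = 1.
Proof.
move=> M0 Mlin Mx /choice[f fP].
have f_uniq y k : M (y - k *: x) -> f y = k.
  move=> My; apply: contrapT => /eqP; rewrite -subr_eq0 => nz; apply: Mx.
  have -> : x = (f y - k)^-1 *: ((-1) *: (y - f y *: x) + (y - k *: x)) + 0.
    by rewrite addr0 scaleN1r opprB addrA subrK -scalerBl scalerA mulVf ?scale1r.
  by apply: (Mlin) => //; apply: Mlin.
have f_lin : linear (f : V -> K^o).
  move=> k y z; apply: f_uniq.
  have -> : k *: y + z - (k * f y + f z) *: x =
            k *: (y - f y *: x) + (z - f z *: x).
    by rewrite scalerDl opprD addrACA scalerBr scalerA.
  exact: Mlin.
pose u : dual V := HB.pack_for {linear V -> K^o} (f : V -> K^o)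
  (GRing.isLinear.Build K V K^o _ _ f_lin).
exists u.
  by move=> y My; apply: f_uniq; rewrite scale0r subr0.
by apply: f_uniq; rewrite scale1r subrr.
Qed.

(** A subspace containing [W] and maximal among those avoiding [x] is a
hyperplane: adding any [y] outside it captures [x], which makes [y] a multiple
of [x] modulo the subspace. *)
Lemma separating_functional (W : set V) (x : V) :
  W 0 -> (forall (k : K) y z, W y -> W z -> W (k *: y + z)) -> ~ W x ->
  exists2 u : dual V, (forall y, W y -> u y = 0) & u x = 1.
Proof.
move=> W0 Wlin Wx.
(* The union with [W] makes the empty chain, whose union is empty, harmless. *)
pose good (X : set V) :=
  (forall (k : K) y z, (W `|` X)%classic y -> (W `|` X)%classic z ->
     (W `|` X)%classic (k *: y + z)) /\ ~ (W `|` X)%classic x.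
have [|M [[Mlin Mx] Mmax]] := @Zorn_bigcup _ good.
  move=> F Fgood Ftot; split; last first.
    by move=> [//|[X /Fgood[_ Xx] ?]]; apply: Xx; right.
  have in1 X k y z : F X -> (W `|` X)%classic y -> (W `|` X)%classic z ->
      (W `|` \bigcup_(X in F) X)%classic (k *: y + z).
    move=> FX hy hz; have [+ _] := Fgood _ FX.
    by move=> /(_ k _ _ hy hz) [?|?]; [left|right; exists X].
  move=> k y z [Wy|[X FX Xy]] [Wz|[Y FY Yz]].
  - by left; apply: Wlin.
  - by apply: (in1 Y) => //; [left|right].
  - by apply: (in1 X) => //; [right|left].
  - have [XY|YX] := Ftot _ _ FX FY.
      by apply: (in1 Y) => //; right => //; apply: XY.
    by apply: (in1 X) => //; right => //; apply: YX.
have M0 : (W `|` M)%classic 0 by left.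
have [|u u0 ux] := hyperplane_functional M0 Mlin Mx; last first.
  by exists u => // y Wy; apply: u0; left.
move=> y; have [My|My] := pselect ((W `|` M)%classic y).
  by exists 0; rewrite scale0r subr0.
apply: contrapT => nk.
(* [M'] is the sum of the maximal subspace and the line of [y]. *)
pose M' : set V := fun z => exists k : K, (W `|` M)%classic (z - k *: y).
have sub z : (W `|` M)%classic z -> M' z.
  by move=> hz; exists 0; rewrite scale0r subr0.
have WM' : (W `|` M')%classic = M'.
  by apply/seteqP; split=> z; [case=> // Wz; apply: sub; left|right].
apply: (Mmax M').
  split; first by move=> z Mz; apply: sub; right.
  move=> /(_ y) h; apply: My; right; apply: h; exists 1.
  by rewrite scale1r subrr.
rewrite /good WM'; split.
  move=> k z1 z2 [k1 h1] [k2 h2]; exists (k * k1 + k2).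
  rewrite scalerDl opprD addrACA -scalerA -scalerBr.
  exact: Mlin.
move=> [k hk]; apply: nk.
have [k0|nz] := eqVneq k 0.
  by case: Mx; move: hk; rewrite k0 scale0r subr0.
exists k^-1.
have -> : y - k^-1 *: x = (- k^-1) *: (x - k *: y) + 0.
  by rewrite addr0 scalerBr !scaleNr scalerA mulVf // scale1r opprK addrC.
exact: Mlin.
Qed.

Lemma span_dichotomy n (b : nat -> V) (x : V) :
  (exists c : nat -> K, x = \sum_(i < n) c i *: b i) \/
  (exists2 u : dual V, (forall i, (i < n)%N -> u (b i) = 0) & u x = 1).
Proof.
have [?|xW] := pselect (exists c : nat -> K, x = \sum_(i < n) c i *: b i).
  by left.
right; pose W : set V := fun y => exists c : nat -> K, y = \sum_(i < n) c i *: b i.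
have [||//|u u0 ux] := @separating_functional W x.
- by exists (fun=> 0); rewrite big1 // => i _; rewrite scale0r.
- move=> k _ _ [c ->] [d ->]; exists (fun i => k * c i + d i).
  rewrite scaler_sumr -big_split /=.
  by apply: eq_bigr => i _; rewrite scalerDl scalerA.
exists u => // i lt_in; apply: u0; exists (fun j => (j == i)%:R).
rewrite (bigD1 (Ordinal lt_in)) //= eqxx scale1r big1 ?addr0 // => j.
by rewrite -val_eqE /= => /negbTE ->; rewrite scale0r.
Qed.

End Functionals.

(** * Contracting the right factor of a tensor *)

Section Slice.
Variables (K : fieldType) (A B : lmodType K).

Section Def.
Variable w : dual B.

Definition slice_pre (x : A) (y : B) : A := (w y : K) *: x.

Fact slice_pre_is_bilinear : bilinear_for *:%R *:%R slice_pre.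
Proof.
split=> [y|x] k s t; rewrite /slice_pre /=.
  by rewrite scalerDr !scalerA mulrC.
by rewrite linearP scalerDl scalerA.
Qed.

HB.instance Definition _ := bilinear_isBilinear.Build K A B A
  *:%R *:%R slice_pre slice_pre_is_bilinear.

Definition slice : {linear tensor A B -> A} := tens_lift slice_pre.

Lemma sliceE x y : slice (x *t y) = (w y : K) *: x.
Proof. exact: tens_liftE. Qed.

End Def.

Lemma tensor_sum_pure (t : tensor A B) :
  exists s : seq (A * B), t = \sum_(p <- s) p.1 *t p.2.
Proof.
rewrite -[t]tensor_reprK -[generic_quotient.repr t]freeg_sumE.
move: (generic_quotient.repr t) => D.
exists [seq (coeff z D *: z.1, z.2) | z <- dom D].
rewrite raddf_sum [RHS]big_map; apply: eq_bigr => -[x y] _ /=.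
rewrite linearZl /= /tens -pi_tensorZ; congr (generic_quotient.pi _ _).
by apply/eqP/freeg_eqP => z; rewrite coeffZ !coeffU mul1r.
Qed.

(** Induction on the number of pure tensors.  If the last [y n] is a
combination of the previous [y i], its term can be distributed over theirs.
Otherwise some functional kills the previous [y i] but not [y n], and slicing
by it gives [x n = 0]. *)
Lemma sum_slice_eq0 n (x : nat -> A) (y : nat -> B) :
  (forall w : dual B, \sum_(i < n) (w (y i) : K) *: x i = 0) ->
  \sum_(i < n) x i *t y i = 0.
Proof.
elim: n x => [|n IHn] x h0; first by rewrite big_ord0.
have [[c yn]|[w w0 w1]] := span_dichotomy n y (y n).
  rewrite big_ord_recr /=.
  have -> : x n *t y n = \sum_(i < n) (c i *: x n) *t y i.
    rewrite {1}yn linear_sumr; apply: eq_bigr => i _ /=.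
    by rewrite linearZr linearZl.
  rewrite -big_split /=.
  under eq_bigr do rewrite -linearDl.
  apply: (IHn (fun i => x i + c i *: x n)) => w.
  rewrite -[RHS](h0 w) big_ord_recr /= yn raddf_sum scaler_suml -big_split /=.
  by apply: eq_bigr => i _; rewrite linearZ_LR /= scalerDr scalerA mulrC.
have xn0 : x n = 0.
  have := h0 w; rewrite big_ord_recr /= big1 ?add0r => [|i _].
    by rewrite w1 scale1r.
  by rewrite w0 ?scale0r.
rewrite big_ord_recr /= xn0 linear0l addr0; apply: IHn => v.
by rewrite -[RHS](h0 v) big_ord_recr /= xn0 scaler0 addr0.
Qed.

(** Iterated, this criterion also applies to tensors with three factors, seen
as elements of [tensor (tensor A A) A]. *)
Lemma slice_eq0 (t : tensor A B) : (forall w, slice w t = 0) -> t = 0.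
Proof.
have [s ->] := tensor_sum_pure t.
rewrite (big_nth (0, 0)) big_mkord => h0.
apply: (sum_slice_eq0 (x := fun i => (nth (0, 0) s i).1)
                      (y := fun i => (nth (0, 0) s i).2)) => w.
by rewrite -[RHS](h0 w) raddf_sum; apply: eq_bigr => i _; rewrite /= sliceE.
Qed.

End Slice.

Arguments slice {K A B} w.

Lemma tens_flip_map (K : fieldType) (A B A' B' : lmodType K)
    (f : {linear A -> A'}) (g : {linear B -> B'}) (t : tensor A B) :
  tens_map g f (tens_flip A B t) = tens_flip A' B' (tens_map f g t).
Proof.
have [s ->] := tensor_sum_pure t.
rewrite !raddf_sum; apply: eq_bigr => p _.
(* [raddf_sum] leaves the maps under other structure projections; the casts
   restore the form that the lemmas on pure tensors match. *)
rewrite -[LHS]/(tens_map g f (tens_flip A B (p.1 *t p.2))).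
rewrite -[RHS]/(tens_flip A' B' (tens_map f g (p.1 *t p.2))).
by rewrite tens_flipE !tens_mapE tens_flipE.
Qed.

Lemma slice_tens_map (K : fieldType) (A B A' B' : lmodType K)
    (f : {linear A -> A'}) (g : {linear B -> B'}) (u : dual B') (t : tensor A B) :
  slice u (tens_map f g t) = f (slice (transpose g u) t).
Proof.
have [s ->] := tensor_sum_pure t; rewrite !raddf_sum; apply: eq_bigr => p _.
rewrite -[LHS]/(slice u (tens_map f g (p.1 *t p.2))).
rewrite -[RHS]/(f (slice (transpose g u) (p.1 *t p.2))).
by rewrite tens_mapE !sliceE linearZ_LR.
Qed.

(** * Slices of an antisymmetric tensor *)

Section AntisymmetricTensor.
Variables (K : fieldType) (A : lmodType K) (br : {bilinear A -> A -> A}).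
Variables (n : nat) (a b : 'I_n -> A) (r : tensor A A).
Hypothesis (def_r : r = \sum_(i < n) a i *t b i).
Hypothesis (r_anti : antisymmetric_tensor r).

(** [Tr a b w] contracts the left factor of [r], that is, the right factor of
its flip [- r]. *)
Lemma slice_antisymmetric (w : dual A) : slice w r = - Tr a b w.
Proof.
rewrite r_anti raddfN def_r; congr (- _).
rewrite !raddf_sum; apply: eq_bigr => i _.
by rewrite -[LHS]/(slice w (tens_flip A A (a i *t b i))) tens_flipE sliceE.
Qed.

Lemma sum_Tr_anti (w : dual A) : \sum_(i < n) (w (b i) : K) *: a i = - Tr a b w.
Proof.
rewrite -slice_antisymmetric def_r raddf_sum; apply: eq_bigr => i _.
by rewrite /= sliceE.
Qed.

(** Contracting by [v] on the last factor and by [u] on the middle one.  In the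
first term both contractions fall on second components of [r], and the two
signs cancel.  In the third term the contraction of [a j] against [b j] yields
[- Tr a b v], which absorbs the minus sign.  The second and third sums then
still carry a [b i] inside a functional and a free [a i], hence one more sign
from [slice_antisymmetric]. *)
Lemma slice_mlybe (brC : forall x y, br x y = br y x) (u v : dual A) :
  slice u (slice v (mlybe br a b)) =
  br (Tr a b u) (Tr a b v)
  - Tr a b (coad br (Tr a b u) v + coad br (Tr a b v) u).
Proof.
have slice3 x y z : slice u (slice v (x *t y *t z)) = (v z * u y : K) *: x.
  by rewrite sliceE linearZ_LR /= sliceE scalerA.
have Tr_coad x w : - Tr a b (coad br x w) = \sum_(i < n) (w (br x (b i)) : K) *: a i.
  by rewrite -sum_Tr_anti.
rewrite raddfD opprD !Tr_coad /mlybe.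
transitivity (\sum_(i < n) \sum_(j < n)
   ((v (b j) * u (b i) : K) *: br (a i) (a j)
    + ((v (br (b i) (b j)) * u (a j) : K) *: a i
    - (v (b j) * u (br (b i) (a j)) : K) *: a i))).
  rewrite !raddf_sum; apply: eq_bigr => i _; rewrite !raddf_sum.
  by apply: eq_bigr => j _; rewrite !raddfB !raddfD /= !slice3 -addrA.
under eq_bigr do rewrite big_split /= sumrB.
rewrite big_split /= sumrB; congr (_ + (_ + _)).
- rewrite -[br (Tr a b u) _]opprK -linearNr -linearNl -!sum_Tr_anti.
  rewrite linear_sumlz; apply: eq_bigr => i _; rewrite linear_sumr.
  by apply: eq_bigr => j _; rewrite linearZl linearZr /= scalerA mulrC.
- apply: eq_bigr => i _; rewrite -scaler_suml; congr (_ *: _).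
  rewrite brC linear_sumr raddf_sum; apply: eq_bigr => j _.
  rewrite linearZr /= linearZ_LR; exact: mulrC.
- rewrite -sumrN; apply: eq_bigr => i _; rewrite -scaler_suml -scaleNr.
  congr (_ *: _).
  rewrite brC -[Tr a b v]opprK -sum_Tr_anti linearNr raddfN; congr (- _).
  rewrite linear_sumr raddf_sum; apply: eq_bigr => j _.
  by rewrite linearZr /= linearZ_LR.
Qed.

End AntisymmetricTensor.

Theorem theorem4p25 (K : fieldType) (charK : [pchar K] =i pred0)
    (A : lmodType K) (br : {bilinear A -> A -> A}) (N : {linear A -> A})
    (hbr : is_mock_lie br) (hN : is_nijenhuis br N)
    (n : nat) (a b : 'I_n -> A) (r : tensor A A)
    (hr : r = \sum_(i < n) a i *t b i) (hanti : antisymmetric_tensor r)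
    (S : {linear A -> A}) :
  admissible_mlybe br N S r a b <->
  (forall u v : dual A,
     br (Tr a b u) (Tr a b v) =
     Tr a b (coad br (Tr a b u) v + coad br (Tr a b v) u)) /\
  N \o Tr a b =1 Tr a b \o transpose S.
Proof.
have brC : forall x y, br x y = br y x by case: hbr.
have slice2 u : slice u ((tens_map N idfun \- tens_map idfun S) r) =
                Tr a b (transpose S u) - N (Tr a b u).
  rewrite -[(_ \- _) r]/(tens_map N idfun r - tens_map idfun S r).
  have sliceB x y : slice u (x - y) = slice u x - slice u y by exact: raddfB.
  rewrite sliceB !slice_tens_map !(slice_antisymmetric hr hanti).
  by rewrite raddfN opprK addrC; congr (Tr a b _ - _); apply: linear_ext.
split=> [[e1 e2 _]|[e1 e2]].
  split=> [u v|u /=]; apply/eqP.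
    by rewrite -subr_eq0 -(slice_mlybe hr hanti brC) e1 !raddf0.
  by rewrite eq_sym -subr_eq0 -slice2 e2 raddf0.
have second0 : (tens_map N idfun \- tens_map idfun S) r = 0.
  by apply: slice_eq0 => u; rewrite slice2 (e2 u : N _ = Tr a b (transpose S u)) subrr.
split=> //.
  apply: slice_eq0 => v; apply: slice_eq0 => u.
  by rewrite (slice_mlybe hr hanti brC) e1 subrr.
(* The third condition is the flip of the second. *)
have swap (f g : {linear A -> A}) :
    tens_map f g r = - tens_flip A A (tens_map g f r).
  by rewrite {1}hanti -tens_flip_map; exact: raddfN.
rewrite -[LHS]/(tens_map S idfun r - tens_map idfun N r).
rewrite (swap S idfun) (swap idfun N) opprK addrC.
transitivity (tens_flip A A ((tens_map N idfun \- tens_map idfun S) r)).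
  exact/esym/raddfB.
by rewrite second0 raddf0.
Qed.
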